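(* Let $k\ge2$ and assume $\overline{\mathbf U}_{ij}\in G$ for all $i,j$. Let interface values $\widetilde{\mathbf U}_{i\pm\frac12,j}^{\mp,\mu},\widetilde{\mathbf U}_{i,j\pm\frac12}^{\mu,\mp}\in\mathbb R^8$ be given whose magnetic components satisfy the discrete divergence-free condition $\nabla_h\cdot\widetilde{\mathbf B}_{ij}=0$ for all $i,j$, and let $\mathbf U_{i\pm\frac12,j}^{\mp,\mu},\mathbf U_{i,j\pm\frac12}^{\mu,\mp}$ be the limited values produced from them by the two-step positivity-preserving limiter described in the context. Then, for all $i,j$, the limited values maintain the discrete divergence-free condition $$\nabla_h\cdot\mathbf B_{ij}=0,$$ and simultaneously satisfy the positivity conditions $$\mathbf U_{i+\frac12,j}^{\pm,\mu}\in G,\qquad\mathbf U_{i,j+\frac12}^{\mu,\pm}\in G\qquad\text{for all }\mu,$$ and, if $k\ge3$, $$\mathbf\Pi_{ij}=\frac{\overline{\mathbf U}_{ij}-\frac{\widehat\omega_1}{\lambda}\left[\lambda_1\left(\mathbf\Pi_{i-\frac12,j}^{+}+\mathbf\Pi_{i+\frac12,j}^{-}\right)+\lambda_2\left(\mathbf\Pi_{i,j-\frac12}^{+}+\mathbf\Pi_{i,j+\frac12}^{-}\right)\right]}{1-2\widehat\omega_1}\in G,$$ where $\mathbf\Pi_{i\pm\frac12,j}^{\mp}=\sum_{\mu=1}^Q\omega_\mu\mathbf U_{i\pm\frac12,j}^{\mp,\mu}$ and $\mathbf\Pi_{i,j\pm\frac12}^{\mp}=\sum_{\mu=1}^Q\omega_\mu\mathbf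 U_{i,j\pm\frac12}^{\mu,\mp}$.
   Context: **States.** $\mathbf U=(\rho,\mathbf m,\mathbf B,E)^\top\in\mathbb R^8$ with $\mathbf m,\mathbf B\in\mathbb R^3$; $\mathcal E(\mathbf U)=E-\frac12\left(\frac{|\mathbf m|^2}\rho+|\mathbf B|^2\right)$; $G=\{\mathbf U:\rho>0,\ \mathcal E(\mathbf U)>0\}$. **Setting.** Uniform rectangular mesh with cells $I_{ij}$, step sizes $\Delta x,\Delta y>0$; cell averages $\overline{\mathbf U}_{ij}$ with density component $\bar\rho_{ij}$. Quadrature weights $\omega_1,\dots,\omega_Q>0$ with $\sum_\mu\omega_\mu=1$. $k$ is the order of the scheme, $L=\lceil\frac{k+2}2\rceil$, $\widehat\omega_1=\frac1{L(L-1)}$. $\lambda_1=\alpha_1^{\rm LF}\Delta t/\Delta x>0$, $\lambda_2=\alpha_2^{\rm LF}\Delta t/\Delta y>0$ are given positive numbers ($\alpha^{\rm LF}_\ell$ numerical viscosity parameters, $\Delta t$ the time step), $\lambda=\lambda_1+\lambda_2$. Values with subscript $i\pm\frac12,j$ and superscript $\mp,\mu$ are at the $\mu$th quadrature node of the right/left edge of $I_{ij}$, taken from inside $I_{ij}$; those with subscript $i,j\pm\frac12$ and superscript $\mu,\mp$ are on the top/bottom edge from inside $I_{ij}$. The discrete divergence of interface values is $$\nabla_h\cdot\mathbf B_{ij}=\sum_{\mu=1}^Q\omega_\mu\left(\frac{(B_1)_{i+\frac12,j}^{-,\mu}-(B_1)_{i-\frac12,j}^{+,\mu}}{\Delta x}+\frac{(B_2)_{i,j+\frac12}^{\mu,-}-(B_2)_{i,j-\frac12}^{\mu,+}}{\Delta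 y}\right),$$ and likewise for tilded quantities. **Limiter**, applied in each cell $I_{ij}$. *Step 1 (density).* For $k\ge3$ let $$\widetilde{\mathbf\Pi}_{ij}=\frac{\overline{\mathbf U}_{ij}-\frac{\widehat\omega_1}\lambda\left[\lambda_1(\widetilde{\mathbf\Pi}_{i-\frac12,j}^++\widetilde{\mathbf\Pi}_{i+\frac12,j}^-)+\lambda_2(\widetilde{\mathbf\Pi}_{i,j-\frac12}^++\widetilde{\mathbf\Pi}_{i,j+\frac12}^-)\right]}{1-2\widehat\omega_1},$$ with $\widetilde{\mathbf\Pi}_{i\pm\frac12,j}^\mp=\sum_\mu\omega_\mu\widetilde{\mathbf U}_{i\pm\frac12,j}^{\mp,\mu}$, $\widetilde{\mathbf\Pi}_{i,j\pm\frac12}^\mp=\sum_\mu\omega_\mu\widetilde{\mathbf U}_{i,j\pm\frac12}^{\mu,\mp}$, and let $\rho_{ij}^\star$ be the first component of $\widetilde{\mathbf\Pi}_{ij}$. Let $\rho_{\min}$ be the minimum, over all $\mu$ and both signs, of $\widetilde\rho_{i\pm\frac12,j}^{\mp,\mu},\widetilde\rho_{i,j\pm\frac12}^{\mu,\mp}$, and also of $\rho_{ij}^\star$ if $k\ge3$. With $\epsilon_1=\min\{10^{-13},\bar\rho_{ij}\}$ put $\theta_1=\min\left\{\left|\frac{\bar\rho_{ij}-\epsilon_1}{\bar\rho_{ij}-\rho_{\min}}\right|,1\right\}$. Replace every density $\widetilde\rho$ among these interface values by $\widetilde{\widetilde\rho}=\theta_1(\widetilde\rho-\bar\rho_{ij})+\bar\rho_{ij}$,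 keeping the other components: $\widetilde{\widetilde{\mathbf U}}=(\widetilde{\widetilde\rho},\widetilde{\mathbf m},\widetilde{\mathbf B},\widetilde E)^\top$. *Step 2 (internal energy).* For $k\ge3$ let $\widetilde{\widetilde{\mathbf\Pi}}_{ij}$ be defined by the same formula as $\widetilde{\mathbf\Pi}_{ij}$ with each interface value $\widetilde{\mathbf U}$ replaced by $\widetilde{\widetilde{\mathbf U}}$. Let $\mathcal E_{\min}$ be the minimum, over all $\mu$ and both signs, of $\mathcal E(\widetilde{\widetilde{\mathbf U}}{}_{i\pm\frac12,j}^{\mp,\mu}),\mathcal E(\widetilde{\widetilde{\mathbf U}}{}_{i,j\pm\frac12}^{\mu,\mp})$, and also of $\mathcal E(\widetilde{\widetilde{\mathbf\Pi}}_{ij})$ if $k\ge3$. With $\epsilon_2=\min\{10^{-13},\mathcal E(\overline{\mathbf U}_{ij})\}$ put $\theta_2=\min\left\{\left|\frac{\mathcal E(\overline{\mathbf U}_{ij})-\epsilon_2}{\mathcal E(\overline{\mathbf U}_{ij})-\mathcal E_{\min}}\right|,1\right\}$, and define the limited values by $$\mathbf U_{i\pm\frac12,j}^{\mp,\mu}=\theta_2(\widetilde{\widetilde{\mathbf U}}{}_{i\pm\frac12,j}^{\mp,\mu}-\overline{\mathbf U}_{ij})+\overline{\mathbf U}_{ij},\qquad\mathbf U_{i,j\pm\frac12}^{\mu,\mp}=\theta_2(\widetilde{\widetilde{\mathbf U}}{}_{i,j\pm\frac12}^{\mu,\mp}-\overline{\mathbf U}_{ij})+\overline{\mathbf U}_{ij}.$$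 If a denominator in $\theta_1$ or $\theta_2$ vanishes, the corresponding $\theta$ is taken to be $1$. *)

(* Defs.v *)
From HB Require Import structures.
From mathcomp Require Import all_boot all_order all_algebra.
From mathcomp Require Import reals.

Set Implicit Arguments.
Unset Strict Implicit.
Unset Printing Implicit Defensive.

Import Order.TTheory GRing.Theory Num.Theory.

Local Open Scope ring_scope.

(* States (rho, m, B, E)^T in R^8: component 0 is rho, components 1-3 are m,
   components 4-6 are B and component 7 is E. *)
Notation state R := 'cV[R]_8.

Definition density (R : realType) (U : state R) : R := U ord0 0.

Definition momentum (R : realType) (U : state R) : 'cV[R]_3 :=
  \col_(d < 3) U (inord (1 + d)) 0.

Definition magnetic (R : realType) (U : state R) : 'cV[R]_3 :=
  \col_(d < 3) U (inord (4 + d)) 0.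

Definition total_energy (R : realType) (U : state R) : R := U ord_max 0.

Definition set_density (R : realType) (r : R) (U : state R) : state R :=
  \col_(c < 8) if c == ord0 then r else U c 0.

Definition sqnorm (R : realType) (v : 'cV[R]_3) : R :=
  \sum_(d < 3) v d 0 ^+ 2.

Definition internal_energy (R : realType) (U : state R) : R :=
  total_energy U
  - 2^-1 * (sqnorm (momentum U) / density U + sqnorm (magnetic U)).

Definition G (R : realType) : {pred state R} :=
  [pred U | (0 < density U) && (0 < internal_energy U)].

Arguments G {R}.

(* The interface values of a cell I_ij taken from inside I_ij:
     V Left   mu = U_{i-1/2,j}^{+,mu},   V Right mu = U_{i+1/2,j}^{-,mu},
     V Bottom mu = U_{i,j-1/2}^{mu,+},   V Top   mu = U_{i,j+1/2}^{mu,-}.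
   Both one-sided values at every interface of the mesh arise exactly once
   this way; e.g. U_{i+1/2,j}^{+,mu} is the Left value of cell (i+1,j). *)
Inductive edge := Left | Right | Bottom | Top.

Definition traces (R : realType) (Q : nat) := edge -> 'I_Q -> state R.

Definition edge_average (R : realType) (Q : nat) (omega : 'I_Q -> R)
    (V : traces R Q) (e : edge) : state R :=
  \sum_(mu < Q) omega mu *: V e mu.

Definition divh (R : realType) (Q : nat) (omega : 'I_Q -> R) (dx dy : R)
    (V : traces R Q) : R :=
  \sum_(mu < Q) omega mu *
    ((magnetic (V Right mu) 0 0 - magnetic (V Left mu) 0 0) / dx
     + (magnetic (V Top mu) 1 0 - magnetic (V Bottom mu) 1 0) / dy).

(* uphalf n is the ceiling of n / 2. *)
Definition lobatto_points (k : nat) : nat := uphalf (k + 2).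

Definition omega_hat1 (R : realType) (k : nat) : R :=
  let L : R := (lobatto_points k)%:R in (L * (L - 1))^-1.

(* Only meaningful for k >= 3: for k = 2 the denominator 1 - 2 omega_hat1
   vanishes. *)
Definition Pi (R : realType) (k Q : nat) (omega : 'I_Q -> R)
    (lambda1 lambda2 : R) (Ubar : state R) (V : traces R Q) : state R :=
  let w := omega_hat1 R k in
  let lambda := lambda1 + lambda2 in
  (1 - 2 * w)^-1 *:
    (Ubar - (w / lambda) *:
       (lambda1 *: (edge_average omega V Left + edge_average omega V Right)
        + lambda2 *: (edge_average omega V Bottom + edge_average omega V Top))).

(* The minimum of a nonempty sequence; seeding with the head adds no value. *)
Definition seq_min (R : realType) (s : seq R) : R :=
  \big[Num.min/head 0 s]_(x <- s) x.

Definition trace_min (R : realType) (k Q : nat) (omega : 'I_Q -> R)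
    (lambda1 lambda2 : R) (f : state R -> R)
    (Ubar : state R) (V : traces R Q) : R :=
  seq_min ([seq f (V e mu) | e <- [:: Left; Right; Bottom; Top],
                             mu <- enum 'I_Q]
           ++ (if (3 <= k)%N then [:: f (Pi k omega lambda1 lambda2 Ubar V)]
               else [::])).

(* a is the cell value of the limited quantity and m its minimum; theta is 1 by
   convention when its denominator vanishes. *)
Definition theta (R : realType) (a m : R) : R :=
  let eps := Num.min (10 ^- 13) a in
  if a - m == 0 then 1 else Num.min `|(a - eps) / (a - m)| 1.

Definition limit_density (R : realType) (k Q : nat) (omega : 'I_Q -> R)
    (lambda1 lambda2 : R) (Ubar : state R) (V : traces R Q) : traces R Q :=
  let rhobar := density Ubar in
  let rhomin := trace_min k omega lambda1 lambda2 (@density R) Ubar V in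
  let theta1 := theta rhobar rhomin in
  fun e mu =>
    set_density (theta1 * (density (V e mu) - rhobar) + rhobar) (V e mu).

Definition limit_energy (R : realType) (k Q : nat) (omega : 'I_Q -> R)
    (lambda1 lambda2 : R) (Ubar : state R) (V : traces R Q) : traces R Q :=
  let Emin := trace_min k omega lambda1 lambda2 (@internal_energy R) Ubar V in
  let theta2 := theta (internal_energy Ubar) Emin in
  fun e mu => theta2 *: (V e mu - Ubar) + Ubar.

Definition limiter (R : realType) (k Q : nat) (omega : 'I_Q -> R)
    (lambda1 lambda2 : R) (Ubar : state R) (V : traces R Q) : traces R Q :=
  limit_energy k omega lambda1 lambda2 Ubar
    (limit_density k omega lambda1 lambda2 Ubar V).

(* Main.v *)
Require Import Defs.
From HB Require Import structures.
From mathcomp Require Import all_boot all_order all_algebra.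
From mathcomp Require Import reals.
From mathcomp Require Import ring lra.

(** Both steps of the limiter contract the interface values towards the cell
    average: the first acts on the densities alone, the second on whole states.

    Positivity.  The factor [theta a m] is chosen so that every number
    [x >= m] is moved by the contraction of centre [a] to a positive number
    ([contraction_theta_gt0]).  The minimum [m] is taken over the interface
    values and, when [3 <= k], over the auxiliary state [Pi], and [Pi] is an
    affine combination of the cell average and the interface values, so that it
    commutes with contractions towards the cell average ([Pi_contraction]).
    Hence one argument treats all these states alike.  The density is linear and
    is handled directly.  The internal energy is not, but it is concave on the
    half-space of positive density ([internal_energy_concave]): it is a lower
    envelope of affine functions of the state ([internal_energy_le_tangent],
    [internal_energy_tangent]).  The internal energy of a contracted state is
    therefore at least the contraction of its internal energy, which is
    positive.

    Divergence.  The first step does not touch the magnetic field.  In the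
    second, the contribution of the cell average cancels in each difference of
    values on opposite edges, and the divergence is multiplied by the
    factor of that step ([divh_contraction]). *)

Set Implicit Arguments.
Unset Strict Implicit.
Unset Printing Implicit Defensive.

Import Order.TTheory GRing.Theory Num.Theory.

Local Open Scope ring_scope.

(** * The contraction factor *)

Lemma seq_min_le (R : realType) (s : seq R) (x : R) : x \in s -> seq_min s <= x.
Proof.
rewrite /seq_min; move: (head 0 s) => x0.
elim: s => // y s IHs; rewrite inE big_cons ge_min.
by case/predU1P => [-> | /IHs ->]; rewrite ?lexx ?orbT.
Qed.

Lemma theta_itv (R : realType) (a m : R) : 0 <= theta a m <= 1.
Proof.
rewrite /theta; case: ifP => _; first by rewrite ler01 lexx.
by rewrite le_min normr_ge0 ler01 ge_min lexx orbT.
Qed.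

(** A positive [x] stays positive on its way to [a].  If [x <= 0] then [m < a],
    and the factor is at most [(a - eps) / (a - m)], the value that moves [m]
    exactly to the threshold [eps]; as [m <= x], it moves [x] no lower. *)
Lemma contraction_theta_gt0 (R : realType) (a m x : R) :
  0 < a -> m <= x -> 0 < theta a m * (x - a) + a.
Proof.
move=> a_gt0 m_le_x.
have /andP[t_ge0 t_le1] := theta_itv a m.
have [x_gt0 | x_le0] := ltP 0 x; first by nra.
have m_lt_a : m < a by lra.
set eps := Num.min (10 ^- 13) a.
have eps_gt0 : 0 < eps by rewrite lt_min a_gt0 invr_gt0 exprn_gt0.
have eps_le_a : eps <= a by rewrite ge_min lexx orbT.
have t_le : theta a m <= (a - eps) / (a - m).
  rewrite /theta subr_eq0 gt_eqF // ge_min ger0_norm ?lexx //.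
  by rewrite divr_ge0 // subr_ge0 ?(ltW m_lt_a).
have : theta a m * (a - m) <= a - eps by rewrite -ler_pdivlMr ?subr_gt0.
by nra.
Qed.

(** * Concavity of the internal energy *)

(** The affine function of [U] that touches the internal energy at the states of
    velocity [v] and magnetic field [b]. *)
Definition energy_tangent (R : realType) (v b : 'cV[R]_3) (U : state R) : R :=
  total_energy U - \sum_(d < 3) v d 0 * momentum U d 0
  - \sum_(d < 3) b d 0 * magnetic U d 0
  + 2^-1 * (sqnorm v * density U + sqnorm b).

(** Completing the squares in the momentum and in the magnetic field. *)
Lemma energy_tangentB (R : realType) (v b : 'cV[R]_3) (U : state R) :
  density U != 0 ->
  energy_tangent v b U - internal_energy U =
  2^-1 * (density U * sqnorm ((density U)^-1 *: momentum U - v)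
          + sqnorm (magnetic U - b)).
Proof.
move=> rho_neq0; rewrite /energy_tangent /internal_energy /sqnorm !big_ord_recr.
by rewrite !big_ord0 /= !mxE; field.
Qed.

Lemma sqnorm_ge0 (R : realType) (v : 'cV[R]_3) : 0 <= sqnorm v.
Proof. by apply: sumr_ge0 => d _; apply: sqr_ge0. Qed.

Lemma internal_energy_le_tangent (R : realType) (v b : 'cV[R]_3) (U : state R) :
  0 < density U -> internal_energy U <= energy_tangent v b U.
Proof.
move=> rho_gt0; rewrite -subr_ge0 energy_tangentB ?gt_eqF //.
rewrite mulr_ge0 ?invr_ge0 ?ler0n // addr_ge0 ?mulr_ge0 ?sqnorm_ge0 //.
exact: ltW.
Qed.

Lemma internal_energy_tangent (R : realType) (U : state R) :
  density U != 0 ->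
  internal_energy U =
  energy_tangent ((density U)^-1 *: momentum U) (magnetic U) U.
Proof.
move=> rho_neq0; apply/esym/eqP; rewrite -subr_eq0 energy_tangentB // !subrr.
by rewrite /sqnorm big1 => [|d _]; rewrite ?mxE ?expr0n // mulr0 addr0 mulr0.
Qed.

Lemma density_contraction (R : realType) (t : R) (U C : state R) :
  density (t *: (U - C) + C) = t * (density U - density C) + density C.
Proof. by rewrite /density !mxE. Qed.

Lemma energy_tangent_contraction (R : realType) (v b : 'cV[R]_3) (t : R)
    (U C : state R) :
  energy_tangent v b (t *: (U - C) + C) =
  t * (energy_tangent v b U - energy_tangent v b C) + energy_tangent v b C.
Proof.
rewrite /energy_tangent density_contraction /total_energy !big_ord_recr.
by rewrite !big_ord0 /= !mxE; ring.
Qed.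

(** The tangent at the intermediate state is exact there, affine along the
    segment, and above the internal energy at both endpoints. *)
Lemma internal_energy_concave (R : realType) (t : R) (U C : state R) :
  0 <= t <= 1 -> 0 < density U -> 0 < density C ->
  t * (internal_energy U - internal_energy C) + internal_energy C
  <= internal_energy (t *: (U - C) + C).
Proof.
move=> /andP[t_ge0 t_le1] rhoU_gt0 rhoC_gt0; set W := t *: (U - C) + C.
have rhoW_gt0 : 0 < density W by rewrite density_contraction; nra.
rewrite (internal_energy_tangent (lt0r_neq0 rhoW_gt0)).
move: (_ *: _) (magnetic W) => v b; rewrite energy_tangent_contraction.
have := internal_energy_le_tangent v b rhoU_gt0.
have := internal_energy_le_tangent v b rhoC_gt0.
by nra.
Qed.

Lemma contraction_theta_in_G (R : realType) (m : R) (U C : state R) :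
  C \in G -> 0 < density U -> m <= internal_energy U ->
  theta (internal_energy C) m *: (U - C) + C \in G.
Proof.
move=> /andP[rhoC_gt0 eC_gt0] rhoU_gt0 m_le.
have t_itv := theta_itv (internal_energy C) m; apply/andP; split.
  by case/andP: t_itv => t_ge0 t_le1; rewrite density_contraction; nra.
apply: lt_le_trans (internal_energy_concave t_itv rhoU_gt0 rhoC_gt0).
exact: contraction_theta_gt0.
Qed.

(** * The auxiliary state and the divergence under contraction *)

Lemma edge_average_contraction (R : realType) (Q : nat) (omega : 'I_Q -> R)
    (t : R) (C : state R) (V W : traces R Q) (c : 'I_8) (e : edge) :
  \sum_(mu < Q) omega mu = 1 ->
  (forall mu, W e mu c 0 = t * (V e mu c 0 - C c 0) + C c 0) ->
  edge_average omega W e c 0 = t * (edge_average omega V e c 0 - C c 0) + C c 0.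
Proof.
move=> omega_sum1 WE; rewrite /edge_average !summxE.
transitivity (\sum_(mu < Q) (t * (omega mu *: V e mu) c 0
                             + omega mu * ((1 - t) * C c 0))).
  by apply: eq_bigr => mu _; rewrite !mxE WE; ring.
by rewrite big_split /= -mulr_sumr -mulr_suml omega_sum1; ring.
Qed.

(** From [3 <= k] on there are at least three Lobatto points, whence
    [omega_hat1 R k <= 1 / 6]. *)
Lemma omega_hat1_neq_half (R : realType) (k : nat) :
  (3 <= k)%N -> 1 - 2 * omega_hat1 R k != 0.
Proof.
move=> k_ge3; rewrite /omega_hat1.
have : 3 <= (lobatto_points k)%:R :> R.
  by rewrite ler_nat; apply: (@uphalf_leq 5); rewrite (leq_add k_ge3).
move: (lobatto_points k)%:R => L L_ge3; have LL1_gt2 : 2 < L * (L - 1) by nra.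
by rewrite subr_eq0 eq_sym lt_eqF // ltr_pdivrMr ?mul1r // (lt_trans _ LL1_gt2).
Qed.

(** Stated for a single component, so that it applies both to the contraction of
    the density alone and to that of the whole state.  The weights of the cell
    average and of the interface values in [Pi] add up to one. *)
Lemma Pi_contraction (R : realType) (k Q : nat) (omega : 'I_Q -> R)
    (lambda1 lambda2 t : R) (C : state R) (V W : traces R Q) (c : 'I_8) :
  (3 <= k)%N -> lambda1 + lambda2 != 0 -> \sum_(mu < Q) omega mu = 1 ->
  (forall e mu, W e mu c 0 = t * (V e mu c 0 - C c 0) + C c 0) ->
  Pi k omega lambda1 lambda2 C W c 0
  = t * (Pi k omega lambda1 lambda2 C V c 0 - C c 0) + C c 0.
Proof.
move=> k_ge3 lambda_neq0 omega_sum1 WE.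
have avgE e := edge_average_contraction omega_sum1 (WE e).
have := omega_hat1_neq_half R k_ge3.
by rewrite /Pi !mxE !avgE => w_neq; field; rewrite lambda_neq0.
Qed.

Lemma divh_contraction (R : realType) (Q : nat) (omega : 'I_Q -> R)
    (dx dy t : R) (C : state R) (V : traces R Q) :
  divh omega dx dy (fun e mu => t *: (V e mu - C) + C) = t * divh omega dx dy V.
Proof.
rewrite /divh mulr_sumr; apply: eq_bigr => mu _.
by rewrite !mxE; ring.
Qed.

Lemma magnetic_set_density (R : realType) (r : R) (U : state R) :
  magnetic (set_density r U) = magnetic U.
Proof.
apply/matrixP => d e; rewrite !mxE -val_eqE /= inordK //.
by case: d => -[|[|[|]]].
Qed.

(** * The limiter in one cell *)

Section CellLimiter.

Context {R : realType} (k Q : nat) (omega : 'I_Q -> R) (lambda1 lambda2 : R).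
Hypotheses (lambda_neq0 : lambda1 + lambda2 != 0).
Hypotheses (omega_sum1 : \sum_(mu < Q) omega mu = 1).

Implicit Types (C : state R) (V : traces R Q).

Local Notation Pi := (Pi k omega lambda1 lambda2).
Local Notation trace_min := (trace_min k omega lambda1 lambda2).
Local Notation limit_density := (limit_density k omega lambda1 lambda2).
Local Notation limit_energy := (limit_energy k omega lambda1 lambda2).
Local Notation limiter := (limiter k omega lambda1 lambda2).

Lemma trace_min_le_trace (f : state R -> R) C V e mu :
  trace_min f C V <= f (V e mu).
Proof.
apply: seq_min_le; rewrite mem_cat; apply/orP; left.
have in_edge e' : f (V e' mu) \in [seq f (V e' nu) | nu <- enum 'I_Q].
  by apply: (map_f (fun nu => f (V e' nu))); rewrite mem_enum.
by rewrite /= !mem_cat; case: e; rewrite in_edge ?orbT.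
Qed.

Lemma trace_min_le_Pi (f : state R -> R) C V :
  (3 <= k)%N -> trace_min f C V <= f (Pi C V).
Proof. by move=> k_ge3; apply: seq_min_le; rewrite k_ge3 mem_cat mem_head orbT. Qed.

Lemma density_limit_density_gt0 C V e mu :
  0 < density C -> 0 < density (limit_density C V e mu).
Proof.
move=> rhoC_gt0; rewrite /density mxE eqxx.
exact/contraction_theta_gt0/trace_min_le_trace.
Qed.

Lemma density_Pi_limit_density_gt0 C V :
  (3 <= k)%N -> 0 < density C -> 0 < density (Pi C (limit_density C V)).
Proof.
move=> k_ge3 rhoC_gt0; rewrite /density.
rewrite (@Pi_contraction _ _ _ _ _ _
  (theta (density C) (trace_min (@density R) C V)) _ V) //; last first.
  by move=> e mu; rewrite mxE eqxx.
exact/contraction_theta_gt0/trace_min_le_Pi.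
Qed.

Lemma limiter_in_G C V e mu : C \in G -> limiter C V e mu \in G.
Proof.
move=> C_G; have /andP[rhoC_gt0 _] := C_G.
apply: contraction_theta_in_G => //; last exact: trace_min_le_trace.
exact: density_limit_density_gt0.
Qed.

Lemma Pi_limiter_in_G C V : (3 <= k)%N -> C \in G -> Pi C (limiter C V) \in G.
Proof.
move=> k_ge3 C_G; have /andP[rhoC_gt0 _] := C_G.
set V1 := limit_density C V.
set t := theta (internal_energy C) (trace_min (@internal_energy R) C V1).
have -> : Pi C (limiter C V) = t *: (Pi C V1 - C) + C.
  apply/matrixP => c z; rewrite ord1 (@Pi_contraction _ _ _ _ _ _ t _ V1) //.
    by rewrite !mxE.
  by move=> e mu; rewrite !mxE.
apply: contraction_theta_in_G => //; last exact: trace_min_le_Pi.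
exact: density_Pi_limit_density_gt0.
Qed.

Lemma divh_limiter dx dy C V :
  divh omega dx dy V = 0 -> divh omega dx dy (limiter C V) = 0.
Proof.
move=> divV; rewrite /limiter /limit_energy divh_contraction.
suff -> : divh omega dx dy (limit_density C V) = divh omega dx dy V.
  by rewrite divV mulr0.
by apply: eq_bigr => mu _; rewrite !magnetic_set_density.
Qed.

End CellLimiter.

Theorem theorem2p9 (R : realType) (k Q : nat) (omega : 'I_Q -> R)
    (dx dy dt alpha1 alpha2 lambda1 lambda2 : R)
    (Ubar : int -> int -> state R)
    (Utilde U : int -> int -> traces R Q)
    (k_ge2 : (2 <= k)%N)
    (omega_gt0 : forall mu, 0 < omega mu)
    (omega_sum1 : \sum_(mu < Q) omega mu = 1)
    (dx_gt0 : 0 < dx) (dy_gt0 : 0 < dy)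
    (lambda1E : lambda1 = alpha1 * dt / dx) (lambda1_gt0 : 0 < lambda1)
    (lambda2E : lambda2 = alpha2 * dt / dy) (lambda2_gt0 : 0 < lambda2)
    (Ubar_G : forall i j, Ubar i j \in G)
    (divh_Utilde : forall i j, divh omega dx dy (Utilde i j) = 0)
    (UE : forall i j,
       U i j = limiter k omega lambda1 lambda2 (Ubar i j) (Utilde i j)) :
  forall i j : int,
    [/\ divh omega dx dy (U i j) = 0,
        forall mu, U i j Right mu \in G /\ U (i + 1) j Left mu \in G,
        forall mu, U i j Top mu \in G /\ U i (j + 1) Bottom mu \in G
      & (3 <= k)%N -> Pi k omega lambda1 lambda2 (Ubar i j) (U i j) \in G].
Proof.
have lambda_neq0 : lambda1 + lambda2 != 0 by rewrite gt_eqF ?addr_gt0.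
move=> i j; split=> [|mu|mu|k_ge3]; rewrite !UE.
- exact: divh_limiter.
- by split; apply: limiter_in_G.
- by split; apply: limiter_in_G.
- exact: Pi_limiter_in_G.
Qed.
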